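(* Let $\Sigma$ be a finite alphabet, let $a,b\in\Sigma$ be two distinct symbols, and let $\sigma$ be a valid block over $\Sigma$ of dimension $4$. Then $\sigma$ is isomorphic to exactly one of the following blocks: 1. $\bar\sigma_1=(1,a)(1,b)(1,a)(1,b)$; 2. $\bar\sigma_2=(1,a)(1,b)(1,a)b(1,a)$; 3. $\bar\sigma_3=(1,a)(1,b)a^2(1,b)(1,a)$; 4. $\bar\sigma_4=(1,a)(1,b)a(1,b)(1,a)$; 5. $\bar\sigma_5=(1,a)(1,b)ab(1,a)(1,b)$; 6. $\bar\sigma_6=(1,a)b(1,a)b(1,a)b(1,a)$.
   Context: $\Sigma^*$ is the set of finite words over $\Sigma$, $1$ denotes the empty word, $x[1]$ is the first symbol of a nonempty word $x$, and $[m]=\{1,\dots,m\}$. Blocks. For $m\ge 0$ an $m$-block is a formal expression $\sigma=x_0(1,a_1)x_1(1,a_2)\cdots x_{m-1}(1,a_m)x_m$ with $x_i\in\Sigma^*$, $a_i\in\Sigma$ (empty words $x_i=1$ are omitted from the notation); $\dim\sigma=m$; $0$-blocks are words. Equivalence of $m$-blocks is defined recursively: $0$-blocks are equivalent iff equal as words; for $m\ge1$, writing $\sigma_i=\hat\sigma_i(1,a_i)x_i$ with $\hat\sigma_i$ an $(m-1)$-block, $a_i\in\Sigma$, $x_i\in\Sigma^*$, one has $\sigma_1\equiv\sigma_2$ iff $\hat\sigma_1a_1x_1\equiv\hat\sigma_2a_2x_2$ and $\hat\sigma_1x_1\equiv\hat\sigma_2x_2$. A block is in canonical form if for every $i=1,\dots,m$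 the word $x_i$ is empty or $x_i[1]\ne a_i$; each equivalence class contains exactly one block in canonical form. Blocks are considered up to equivalence (''='' means equivalent). Sub-blocks. For disjoint $I^+,I^-\subset[m]$, $\sigma(I^+,I^-)=x_0\lambda_1x_1\cdots\lambda_mx_m$ where $\lambda_i=a_i$ if $i\in I^+$, $\lambda_i=1$ if $i\in I^-$, and $\lambda_i=(1,a_i)$ otherwise. Validity. $\sigma$, with canonical form $x_0(1,a_1)x_1\cdots(1,a_m)x_m$, is valid if for every $i=1,\dots,m-1$ with $x_i=1$ one has $a_i\ne a_{i+1}$. Isomorphism. Two valid $m$-blocks $\sigma_1,\sigma_2$ are isomorphic if there is a permutation $\pi$ of $[m]$ such that for all $I^\pm,J^\pm\subset[m]$ with $I^+\cap I^-=\emptyset=J^+\cap J^-$: (i) $\sigma_1(I^+,I^-)$ is valid iff $\sigma_2(\pi(I^+),\pi(I^-))$ is valid; and (ii) $\sigma_1(I^+,I^-)=\sigma_1(J^+,J^-)$ and this block is valid iff $\sigma_2(\pi(I^+),\pi(I^-))=\sigma_2(\pi(J^+),\pi(J^-))$ and this block is valid. *)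

(* Defs.v *)
From mathcomp Require Import all_boot all_fingroup.
Set Implicit Arguments.
Unset Strict Implicit.
Unset Printing Implicit Defensive.

(* x_0 (1,a_1) x_1 ... (1,a_m) x_m is
   Snoc (... (Snoc (Word x_0) a_1 x_1) ...) a_m x_m. *)
Inductive block (Sigma : Type) : Type :=
| Word of seq Sigma
| Snoc of block Sigma & Sigma & seq Sigma.

Arguments Word {Sigma}.
Arguments Snoc {Sigma}.

Fixpoint dim (Sigma : Type) (s : block Sigma) : nat :=
  if s is Snoc s' _ _ then (dim s').+1 else 0.

Definition mkblock (Sigma : Type) (x0 : seq Sigma)
    (l : seq (Sigma * seq Sigma)) : block Sigma :=
  foldl (fun s p => Snoc s p.1 p.2) (Word x0) l.

(* Right multiplication of a block by a word. *)
Definition rcat (Sigma : Type) (s : block Sigma) (w : seq Sigma) :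
    block Sigma :=
  match s with
  | Word x => Word (x ++ w)
  | Snoc s' a x => Snoc s' a (x ++ w)
  end.

(* The premises of equiv_snoc have dimension one less than its conclusion, so
   this is the recursive definition on the dimension; blocks of different
   dimensions are never equivalent. *)
Inductive equiv (Sigma : Type) : block Sigma -> block Sigma -> Prop :=
| equiv_word w : equiv (Word w) (Word w)
| equiv_snoc s1 a1 x1 s2 a2 x2 :
    equiv (rcat s1 (a1 :: x1)) (rcat s2 (a2 :: x2)) ->
    equiv (rcat s1 x1) (rcat s2 x2) ->
    equiv (Snoc s1 a1 x1) (Snoc s2 a2 x2).

Fixpoint canonical (Sigma : eqType) (s : block Sigma) : bool :=
  if s is Snoc s' a x then canonical s' && (ohead x != Some a) else true.

(* a_i <> a_(i+1) for every i = 1, ..., m-1 with x_i empty. *)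
Fixpoint separated (Sigma : eqType) (s : block Sigma) : bool :=
  match s with
  | Snoc (Snoc _ a x as s') b _ => separated s' && ((x == [::]) ==> (a != b))
  | _ => true
  end.

(* t is the canonical form of s, unique in the class of s. *)
Definition valid (Sigma : eqType) (s : block Sigma) : Prop :=
  exists t : block Sigma, [/\ equiv s t, canonical t & separated t].

(* Indices are 0-based: the pair (1,a) in Snoc s' a x has index dim s'. *)
Definition mem_nat (m : nat) (I : {set 'I_m}) (k : nat) : bool :=
  [exists i in I, val i == k].

Fixpoint subblock (Sigma : Type) (m : nat) (s : block Sigma)
    (Ip Im : {set 'I_m}) : block Sigma :=
  match s with
  | Word x => Word x
  | Snoc s' a x =>
      if mem_nat Ip (dim s') then rcat (subblock s' Ip Im) (a :: x)
      else if mem_nat Im (dim s') then rcat (subblock s' Ip Im) x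
      else Snoc (subblock s' Ip Im) a x
  end.

Definition isomorphic (Sigma : eqType) (s1 s2 : block Sigma) : Prop :=
  [/\ valid s1, valid s2, dim s1 = dim s2 &
  exists p : {perm 'I_(dim s1)}, forall Ip Im Jp Jm : {set 'I_(dim s1)},
    Ip :&: Im = set0 -> Jp :&: Jm = set0 ->
    (valid (subblock s1 Ip Im) <-> valid (subblock s2 (p @: Ip) (p @: Im)))
    /\
    ((equiv (subblock s1 Ip Im) (subblock s1 Jp Jm)
        /\ valid (subblock s1 Ip Im))
     <->
     (equiv (subblock s2 (p @: Ip) (p @: Im)) (subblock s2 (p @: Jp) (p @: Jm))
        /\ valid (subblock s2 (p @: Ip) (p @: Im))))].

Definition standard_block (Sigma : Type) (a b : Sigma) (i : 'I_6) :
    block Sigma :=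
  tnth [tuple
    mkblock [::] [:: (a, [::]); (b, [::]); (a, [::]); (b, [::])];
    mkblock [::] [:: (a, [::]); (b, [::]); (a, [:: b]); (a, [::])];
    mkblock [::] [:: (a, [::]); (b, [:: a; a]); (b, [::]); (a, [::])];
    mkblock [::] [:: (a, [::]); (b, [:: a]); (b, [::]); (a, [::])];
    mkblock [::] [:: (a, [::]); (b, [:: a; b]); (a, [::]); (b, [::])];
    mkblock [::] [:: (a, [:: b]); (a, [:: b]); (a, [:: b]); (a, [::])]] i.

(* Main.v *)
From Corelib Require Import Setoid.
From mathcomp Require Import all_boot all_fingroup.
Require Import Defs.
Set Implicit Arguments.
Unset Strict Implicit.
Unset Printing Implicit Defensive.

(** An m-block is a cube of words: choosing for every pair (1,a) whether to
    keep or to drop the letter a gives one word for each vertex of {0,1}^m.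
    Unfolding the recursive definition, two blocks are equivalent exactly when
    their words agree at all vertices ([equivP]).

    Validity is also visible on the vertices.  A pair of neighbours
    (1,a) x (1,b) obstructs validity when a x = x b, that is when x is a power
    of a = b; in canonical form this means x = 1 and a = b.  The equation says
    that keeping only the left letter and keeping only the right one give the
    same word ([validP], [reducedP]).  So the only thing that isomorphism sees
    is the kernel of the cube, the relation of having the same word at two
    vertices; blocks whose kernels agree, directly or after reversing the
    order of the coordinates, are isomorphic ([isomorphic_of_kernel]).

    The kernel of a valid block is small.  Suppose that two vertices carry the
    same word and first differ at i, where only the first of them keeps its
    letter a.  Then the second one drops the letter i+1 as well: if it kept
    this letter b then, after cancelling the common prefix, one word would
    start with a x and the other with x b, where x is the word between the two
    letters.  The same holds at the last difference ([gapped_last] proves this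
    version, and mirroring gives the other).  As both vertices keep equally
    many letters, in dimension 4 this leaves, up to cancellation of common
    letters at both ends, the four coincidences
        {1} = {3},  {2} = {4},  {1} = {4},  {1,2} = {3,4}
    of sets of kept letters.  The third excludes the first two (it would give
    {3} = {4} or {1} = {2}), and any two of {1} = {3}, {2} = {4} and
    {1,2} = {3,4} imply the other one, through {1,4}.  Of the seven patterns
    that survive, six are those of the standard blocks and the seventh, only
    {2} = {4}, is the reversal of the second one ([signature_cases]).

    For uniqueness, an isomorphism permutes the vertices and preserves the
    kernel, so it preserves the sum of the sizes of I union J over all
    coinciding pairs I, J.  This number takes six different values on the
    standard blocks ([cube_weight_std]). *)

(** * Words at the vertices of a block *)

(** The bit of the last pair comes first, following the way blocks are built;
    missing bits count as dropped letters. *)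
Fixpoint word_at (S : Type) (s : block S) (u : bitseq) : seq S :=
  match s with
  | Word x => x
  | Snoc s' a x => word_at s' (behead u) ++ nseq (head false u) a ++ x
  end.

Lemma dim_rcat (S : Type) (s : block S) w : dim (rcat s w) = dim s.
Proof. by case: s. Qed.

Lemma word_at_rcat (S : Type) (s : block S) w u :
  word_at (rcat s w) u = word_at s u ++ w.
Proof. by case: s => [x|s a x] //=; rewrite !catA. Qed.

(** The two premises of the recursive definition fix the last coordinate to
    kept and to dropped, so unfolding it runs through all vertices. *)
Lemma equivP (S : Type) (s t : block S) :
  equiv s t <->
  dim s = dim t /\ forall u, size u = dim s -> word_at s u = word_at t u.
Proof.
split.
  elim=> [w|s1 a1 x1 s2 a2 x2 _ [d1 e1] _ [_ e0]] //=.
  rewrite !dim_rcat in d1 e1 e0; split=> [|[|c u] //= [su]]; first by rewrite d1.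
  move: (e1 u su) (e0 u su); rewrite !word_at_rcat.
  by case: c.
move En: (dim s) => n; elim: n s t En => [|n IH] [x|s a x] [y|t b y] //=.
- by move=> _ [_ /(_ [::] erefl) ->]; constructor.
- by move=> _ [].
- by move=> _ [].
case=> ds [[dt] e]; constructor; apply: IH; rewrite ?dim_rcat //; split=> //
  u su; rewrite !word_at_rcat.
  exact: (e (true :: u) (congr1 succn su)).
exact: (e (false :: u) (congr1 succn su)).
Qed.

(** * Validity read off the vertices *)

(** Unlike being separated, the condition a x <> x b makes sense for blocks
    that are not in canonical form, and it only depends on the equivalence
    class. *)
Fixpoint reduced (S : eqType) (s : block S) : bool :=
  match s with
  | Snoc (Snoc _ a x as s') b _ => reduced s' && (a :: x != rcons x b)
  | _ => true
  end.

Lemma cat_inj_size (S : Type) (x x' y y' : seq S) :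
  size y = size y' -> x ++ y = x' ++ y' -> x = x' /\ y = y'.
Proof.
move=> syy' e; have sxx' : size x = size x'.
  by move/(congr1 size): e; rewrite !size_cat syy'; apply: addIn.
split; first by move/(congr1 (take (size x))): e; rewrite {2}sxx' !take_size_cat.
by move/(congr1 (drop (size x))): e; rewrite {2}sxx' !drop_size_cat.
Qed.

Lemma catIs (S : Type) (x y z : seq S) : x ++ z = y ++ z -> x = y.
Proof. by case/cat_inj_size. Qed.

Lemma catsI (S : Type) (x y z : seq S) : x ++ y = x ++ z -> y = z.
Proof. by elim: x => [|c x IH] //= [/IH]. Qed.

Lemma reduced_tail (S : eqType) (s : block S) b y :
  reduced (Snoc s b y) -> reduced s.
Proof. by case: s => //= s a x /andP[]. Qed.

(** Two vertices that keep opposite ones of two neighbouring letters, and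
    agree elsewhere, have words with the same ends around a x and x b. *)
Lemma reducedP (S : eqType) (s : block S) :
  reduced s <->
  forall u v, (size u + size v).+2 = dim s ->
    word_at s (u ++ [:: true, false & v]) <>
    word_at s (u ++ [:: false, true & v]).
Proof.
elim: s => [x|s IH b y] /=; first by split.
split.
  move=> red [|c u] v /= [suv].
    case: s suv red {IH} => [x|s a x] //= _ /andP[_ /eqP ne].
    rewrite -!catA /= -cat_rcons => /catsI; rewrite -cat_cons => /catIs e.
    by apply: ne.
  by move=> /catIs; apply: IH.1 (reduced_tail red) _ _ suv.
move=> H.
have red : reduced s.
  apply/IH => u v suv e; apply: (H (false :: u) v) => /=; first by rewrite -suv.
  by rewrite e.
case: s red H {IH} => [//|s a x] -> H /=; apply/eqP => e.
apply: (H [::] (nseq (dim s) false)) => /=; first by rewrite size_nseq.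
by rewrite -!catA /= -cat_rcons -e.
Qed.

Lemma reduced_equiv (S : eqType) (s t : block S) :
  equiv s t -> reduced t -> reduced s.
Proof.
case/equivP=> d e /reducedP red; apply/reducedP => u v suv.
rewrite !e; first by apply: red; rewrite -d.
  by rewrite size_cat /= !addnS.
by rewrite size_cat /= !addnS.
Qed.

(** If x does not start with a, then a x = x b forces x to be empty. *)
Lemma canonical_reduced (S : eqType) (s : block S) :
  canonical s -> reduced s = separated s.
Proof.
elim: s => [//|[//|s a x] IH b y] /andP[can _].
change (reduced (Snoc s a x) && (a :: x != rcons x b)
        = separated (Snoc s a x) && ((x == [::]) ==> (a != b))).
rewrite IH //; congr andb; move/andP: can => [_].
case: x {IH} => [|c x] /=; first by rewrite eqseq_cons andbT.
by move=> ne; apply: contra ne => /eqP[-> _].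
Qed.

Lemma strip_letter (S : eqType) (a : S) (x : seq S) :
  exists k y, x = nseq k a ++ y /\ ohead y != Some a.
Proof.
elim: x => [|c x [k [y [-> h]]]]; first by exists 0, [::].
have [->|ne] := eqVneq c a; first by exists k.+1, y.
by exists 0, (c :: nseq k a ++ y).
Qed.

(** As (1,a) a and a (1,a) are equivalent, the leading letters a of x_m can be
    moved to the left of the last pair; the rest is an induction on the
    dimension. *)
Lemma canonical_form (S : eqType) (s : block S) :
  exists2 t, equiv s t & canonical t.
Proof.
move En: (dim s) => n; elim: n s En => [|n IH] [x|s a x] //=.
  by exists (Word x) => //; constructor.
case=> ds; have [k [y [-> hy]]] := strip_letter a x.
have [|t /equivP[dt et] ct] := IH (rcat s (nseq k a)); first by rewrite dim_rcat.
rewrite dim_rcat in dt et.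
exists (Snoc t a y); last by rewrite /= ct.
apply/equivP; split=> [|[|c u] //= [su]]; first by rewrite /= dt.
rewrite -et // word_at_rcat -!catA; congr (_ ++ _).
rewrite !catA; congr (_ ++ _); rewrite -!nseqD addnC //.
Qed.

Lemma validP (S : eqType) (s : block S) : valid s <-> reduced s.
Proof.
split=> [[t [e can sep]]|red].
  by apply: reduced_equiv e _; rewrite canonical_reduced.
have [t e can] := canonical_form s; exists t; split=> //.
rewrite -canonical_reduced //; apply: reduced_equiv red.
by case/equivP: e => d e; apply/equivP; split=> // u su; rewrite e // d.
Qed.

(** * Sub-blocks as faces of the cube *)

(** A face is given by one label per coordinate, None marking the free ones;
    [fill t u] is the vertex of the cube that the face t has at u. *)
Fixpoint fill (t : seq (option bool)) (u : bitseq) : bitseq :=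
  match t with
  | [::] => [::]
  | Some b :: t' => b :: fill t' u
  | None :: t' => head false u :: fill t' (behead u)
  end.

Definition nfree (t : seq (option bool)) := count (pred1 None) t.

Lemma size_fill t u : size (fill t u) = size t.
Proof. by elim: t u => [|[b|] t IH] u //=; rewrite IH. Qed.

Lemma fill_cat t1 t2 u1 u2 :
  size u1 = nfree t1 -> fill (t1 ++ t2) (u1 ++ u2) = fill t1 u1 ++ fill t2 u2.
Proof.
elim: t1 u1 => [|[b|] t1 IH] u1 /=; first by move/size0nil->.
  by move=> s1; rewrite IH.
by case: u1 => [|c u1] //= [s1]; rewrite IH.
Qed.

(** The flag r lets one argument serve the identity and the reversal of the
    coordinates. *)
Definition flip (T : Type) (r : bool) (x : seq T) := if r then rev x else x.

Lemma flipK (T : Type) r : involutive (@flip T r).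
Proof. by case: r => x //=; rewrite revK. Qed.

Lemma size_flip (T : Type) r (x : seq T) : size (flip r x) = size x.
Proof. by case: r => //=; rewrite size_rev. Qed.

Lemma nfree_flip r t : nfree (flip r t) = nfree t.
Proof. by case: r => //=; rewrite /nfree count_rev. Qed.

Lemma fill_flip r t u :
  size u = nfree t -> fill (flip r t) (flip r u) = flip r (fill t u).
Proof.
case: r => //=; elim: t u => [|[b|] t IH] u //=.
  by move=> su; rewrite !rev_cons -!cats1 -[rev u]cats0 fill_cat ?IH //
    size_rev /nfree count_rev.
case: u => [|c u] //= [su]; rewrite !rev_cons -!cats1 fill_cat ?IH //.
by rewrite size_rev /nfree count_rev.
Qed.

Definition label m (Ip Im : {set 'I_m}) k : option bool :=
  if mem_nat Ip k then Some true else if mem_nat Im k then Some false else None.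

Definition labels m (Ip Im : {set 'I_m}) n := rev (mkseq (label Ip Im) n).

Lemma labelsS m (Ip Im : {set 'I_m}) n :
  labels Ip Im n.+1 = label Ip Im n :: labels Ip Im n.
Proof. by rewrite /labels mkseqS rev_rcons. Qed.

Lemma size_labels m (Ip Im : {set 'I_m}) n : size (labels Ip Im n) = n.
Proof. by rewrite size_rev size_mkseq. Qed.

Lemma word_at_subblock (S : Type) m (s : block S) (Ip Im : {set 'I_m}) u :
  word_at (subblock s Ip Im) u = word_at s (fill (labels Ip Im (dim s)) u).
Proof.
elim: s u => [//|s IH a x] u.
rewrite [dim _]/= labelsS /= /label.
case: ifP => _ /=; first by rewrite word_at_rcat IH.
by case: ifP => _ /=; rewrite ?word_at_rcat IH.
Qed.

Lemma dim_subblock (S : Type) m (s : block S) (Ip Im : {set 'I_m}) :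
  dim (subblock s Ip Im) = nfree (labels Ip Im (dim s)).
Proof.
elim: s => [//|s IH a x].
rewrite [dim (Snoc _ _ _)]/= labelsS /= /label.
case: ifP => _ /=; first by rewrite dim_rcat IH.
by case: ifP => _ /=; rewrite ?dim_rcat IH.
Qed.

Lemma mem_nat_ord m (I : {set 'I_m}) (i : 'I_m) : mem_nat I i = (i \in I).
Proof.
apply/existsP/idP => [[j /andP[jI /eqP/val_inj <-]] //|iI].
by exists i; rewrite iI /=.
Qed.

Definition flip_perm n (r : bool) : {perm 'I_n} :=
  if r then perm (@rev_ord_inj n) else 1%g.

Lemma labels_flip n r (Ip Im : {set 'I_n}) :
  labels (flip_perm n r @: Ip) (flip_perm n r @: Im) n
  = flip r (labels Ip Im n).
Proof.
case: r => /=; last first.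
  have im1 (I : {set 'I_n}) : [set (1%g : {perm 'I_n}) i | i in I] = I.
    by rewrite -[RHS]imset_id; apply: eq_imset => i; rewrite perm1.
  by rewrite !im1.
rewrite /labels; congr rev.
apply: (@eq_from_nth _ None); rewrite ?size_rev !size_mkseq // => k kn.
have rn : n - k.+1 < n by rewrite -subn_gt0 subKn.
rewrite nth_rev ?size_mkseq // !nth_mkseq //.
have mem (I : {set 'I_n}) :
    mem_nat (perm (@rev_ord_inj n) @: I) k = mem_nat I (n - k.+1).
  rewrite -[k]/(val (Ordinal kn)) -[n - _]/(val (Ordinal rn)) !mem_nat_ord.
  have -> : Ordinal kn = perm (@rev_ord_inj n) (Ordinal rn).
    by apply: val_inj; rewrite permE /= subnSK // subKn // ltnW.
  by rewrite mem_imset //; apply: perm_inj.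
by rewrite /label !mem.
Qed.

(** * Isomorphism from equality of kernels *)

Definition face_reduced (S : eqType) (s : block S) (t : seq (option bool)) :=
  forall u v, (size u + size v).+2 = nfree t ->
    word_at s (fill t (u ++ [:: true, false & v])) <>
    word_at s (fill t (u ++ [:: false, true & v])).

Definition face_eq (S : eqType) (s : block S) (t t' : seq (option bool)) :=
  nfree t = nfree t' /\
  forall u, size u = nfree t -> word_at s (fill t u) = word_at s (fill t' u).

Lemma valid_subblock (S : eqType) m (s : block S) (Ip Im : {set 'I_m}) :
  valid (subblock s Ip Im) <-> face_reduced s (labels Ip Im (dim s)).
Proof.
rewrite validP reducedP dim_subblock.
by split=> H u v suv; move: (H u v suv); rewrite !word_at_subblock.
Qed.

Lemma equiv_subblock (S : eqType) m (s : block S) (Ip Im Jp Jm : {set 'I_m}) :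
  equiv (subblock s Ip Im) (subblock s Jp Jm) <->
  face_eq s (labels Ip Im (dim s)) (labels Jp Jm (dim s)).
Proof.
rewrite equivP !dim_subblock.
by split=> -[e H]; split=> // u su; move: (H u su); rewrite !word_at_subblock.
Qed.

Definition same_kernel r (S T : eqType) (s : block S) (t : block T) :=
  forall u v, size u = dim s -> size v = dim s ->
  (word_at s u == word_at s v) = (word_at t (flip r u) == word_at t (flip r v)).

Lemma same_kernel_sym r (S T : eqType) (s : block S) (t : block T) :
  dim s = dim t -> same_kernel r s t -> same_kernel r t s.
Proof. by move=> d ker u v su sv; rewrite ker ?size_flip ?flipK // d. Qed.

Lemma face_reduced_flip r (S T : eqType) (s : block S) (s' : block T) t :
  same_kernel r s s' -> size t = dim s ->
  face_reduced s' (flip r t) -> face_reduced s t.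
Proof.
move=> ker st; rewrite /face_reduced nfree_flip => H u v suv /eqP.
rewrite ker ?size_fill // -!fill_flip ?size_cat /= ?addnS //.
case: r H {ker} => /= H /eqP; last exact: H.
rewrite !rev_cat !rev_cons -!cats1 -!catA /= => /esym.
by apply: H; rewrite !size_rev addnC.
Qed.

Lemma face_eq_flip r (S T : eqType) (s : block S) (s' : block T) t t' :
  same_kernel r s s' -> size t = dim s -> size t' = dim s ->
  face_eq s' (flip r t) (flip r t') -> face_eq s t t'.
Proof.
move=> ker st st' [e H]; rewrite !nfree_flip in e H; split=> // u su.
apply/eqP; rewrite ker ?size_fill // -!fill_flip -?e //; apply/eqP/H.
by rewrite size_flip.
Qed.

(** Both validity of a sub-block and equality of two sub-blocks are statements
    about which vertices of the cube carry the same word.  Equality of faces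
    matches their free coordinates in increasing order, which a general
    permutation disturbs; the reversal only exchanges the order for the
    opposite one on both faces. *)
Lemma isomorphic_of_kernel r (S : eqType) (s1 s2 : block S) :
  valid s1 -> valid s2 -> dim s1 = dim s2 -> same_kernel r s1 s2 ->
  isomorphic s1 s2.
Proof.
move=> val1 val2 ed ker; have ker' := same_kernel_sym ed ker.
split=> //; exists (flip_perm _ r) => Ip Im Jp Jm _ _.
rewrite !valid_subblock !equiv_subblock -ed !labels_flip.
have redE t : size t = dim s1 ->
    face_reduced s1 t <-> face_reduced s2 (flip r t).
  move=> st; split; last exact: face_reduced_flip.
  rewrite -[X in face_reduced s1 X](flipK r).
  by apply: face_reduced_flip; rewrite ?size_flip -?ed.
have eqE t t' : size t = dim s1 -> size t' = dim s1 ->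
    face_eq s1 t t' <-> face_eq s2 (flip r t) (flip r t').
  move=> st st'; split; last exact: face_eq_flip.
  rewrite -[X in face_eq s1 X](flipK r) -[X in face_eq s1 _ X](flipK r).
  by apply: face_eq_flip; rewrite ?size_flip -?ed.
by rewrite redE ?eqE ?size_labels.
Qed.

(** * Coincidences between vertices *)

Fixpoint lcons (S : Type) (x : seq S) (a : S) (s : block S) : block S :=
  match s with
  | Word y => Snoc (Word x) a y
  | Snoc s' b y => Snoc (lcons x a s') b y
  end.

Fixpoint mirror (S : Type) (s : block S) : block S :=
  match s with
  | Word x => Word (rev x)
  | Snoc s' a x => lcons (rev x) a (mirror s')
  end.

Lemma dim_lcons (S : Type) x (a : S) s : dim (lcons x a s) = (dim s).+1.
Proof. by elim: s => //= s -> . Qed.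

Lemma dim_mirror (S : Type) (s : block S) : dim (mirror s) = dim s.
Proof. by elim: s => //= s <- a x; rewrite dim_lcons. Qed.

Lemma word_at_lcons (S : Type) x (a : S) s u c :
  size u = dim s ->
  word_at (lcons x a s) (rcons u c) = x ++ nseq c a ++ word_at s u.
Proof.
elim: s u => [y|s IH b y] [|d u] //= [su].
by rewrite IH // !catA.
Qed.

Lemma word_at_mirror (S : Type) (s : block S) u :
  size u = dim s -> word_at (mirror s) (rev u) = rev (word_at s u).
Proof.
elim: s u => [x|s IH a x] [|c u] //= [su].
rewrite rev_cons word_at_lcons ?size_rev ?dim_mirror // IH // !rev_cat catA.
by rewrite rev_nseq.
Qed.

(** Mirroring is used to transfer what is proved at the end of the words to
    their beginning. *)
Lemma mirror_kernel (S : eqType) (s : block S) : same_kernel true s (mirror s).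
Proof.
by move=> u v su sv /=; rewrite !word_at_mirror // (inj_eq (can_inj revK)).
Qed.

Lemma reduced_mirror (S : eqType) (s : block S) :
  reduced s -> reduced (mirror s).
Proof.
move=> /reducedP red; apply/reducedP => u v.
rewrite dim_mirror => suv.
rewrite -[u ++ _]revK -[u ++ [:: false, _ & _]]revK.
rewrite !word_at_mirror ?size_rev ?size_cat /= ?addnS //.
move=> /(can_inj revK); rewrite !rev_cat !rev_cons -!cats1 -!catA /= => /esym.
by apply: red; rewrite !size_rev addnC.
Qed.

(** At the first entry where the bit lists differ, the list that drops the
    letter drops the following one too. *)
Fixpoint gapped (u v : bitseq) : bool :=
  match u, v with
  | b :: u', c :: v' =>
      if b == c then gapped u' v' else ~~ head false (if b then v' else u')
  | _, _ => true
  end.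

Lemma word_at_cons (S : eqType) (s : block S) c d u v :
  (word_at s (c :: u) == word_at s (c :: v))
  = (word_at s (d :: u) == word_at s (d :: v)).
Proof.
case: s => [x|s a x] /=; first by rewrite !eqxx.
by apply/eqP/eqP => /catIs ->.
Qed.

Lemma word_at_rcons (S : eqType) (s : block S) c d u v :
  size u = (dim s).-1 -> size v = (dim s).-1 -> 0 < dim s ->
  (word_at s (rcons u c) == word_at s (rcons v c))
  = (word_at s (rcons u d) == word_at s (rcons v d)).
Proof.
move=> su sv s0.
have size1 (w : bitseq) b : size w = (dim s).-1 -> size (rcons w b) = dim s.
  by move=> sw; rewrite size_rcons sw prednK.
have mir b := mirror_kernel (size1 u b su) (size1 v b sv).
by rewrite (mir c) (mir d) /= !rev_rcons; apply: word_at_cons.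
Qed.

(** After cancelling the common suffix, one word ends with the letter b of the
    last difference.  If the other vertex kept the previous letter a, followed
    by x, its word would end with a x and the first one with x b, words of the
    same length, which [reduced] forbids. *)
Lemma gapped_last (S : eqType) (s : block S) u v :
  reduced s -> size u = dim s -> size v = dim s ->
  word_at s u = word_at s v -> gapped u v.
Proof.
elim: s u v => [x|s IH b y] [|c u] [|d v] //= red [su] [sv].
have [<- /catIs|ne] := eqVneq c d.
  by apply: IH => //; apply: reduced_tail red.
(* The vertex that keeps the letter is called u. *)
wlog: c d u v su sv ne / c.
  move=> W; case: c ne W => ne W; first exact: W.
  case: d ne W => // _ W /esym; exact: (W true false).
case: c ne => //; case: d => //= _ _.
case: s red su sv {IH} => [x|s a x] /=; first by move=> _ _ /size0nil ->.
case/andP=> _ ax; case: u => // e u; case: v => // -[] //= v [su] [sv].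
rewrite -[b :: y]cat1s !catA => /catIs; rewrite -!catA cats1 => E.
case/negP: ax; apply/eqP/esym; move: E.
by rewrite !catA => /cat_inj_size[|_ ->]; rewrite //= ?size_rcons.
Qed.

Lemma size_word_at (S : Type) (s : block S) u :
  size u = dim s ->
  size (word_at s u) = size (word_at s [::]) + count id u.
Proof.
elim: s u => [x|s IH a x] [|c u] //=; first by rewrite addn0.
move=> [su]; rewrite !size_cat IH // size_nseq /=.
by rewrite -!addnA; congr (_ + _); rewrite addnCA [RHS]addnCA [size x + _]addnC.
Qed.

(** * The kernel of a valid block of dimension 4 *)

Fixpoint cube n : seq bitseq :=
  if n is n'.+1 then map (cons true) (cube n') ++ map (cons false) (cube n')
  else [:: [::]].

Lemma mem_cube n u : (u \in cube n) = (size u == n).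
Proof.
elim: n u => [|n IH] [|b u] //=; rewrite mem_cat.
  by apply/norP; split; apply/mapP => -[].
have memc c : (b :: u \in map (cons c) (cube n)) = (b == c) && (size u == n).
  apply/mapP/andP => [[v vn [-> ->]]|[/eqP-> un]]; first by rewrite -IH eqxx.
  by exists u; rewrite ?IH.
by rewrite !memc eqSS; case: b {memc}; rewrite ?orbF.
Qed.

Lemma cube_uniq n : uniq (cube n).
Proof.
elim: n => //= n IH; rewrite cat_uniq !map_inj_uniq ?IH; try by move=> ? ? [].
by rewrite andbT /=; apply/hasPn => u /mapP[v _ ->]; apply/mapP => -[].
Qed.

(** With the last coordinate first, these are the coincidences {1} = {3},
    {2} = {4}, {1} = {4} and {1,2} = {3,4} of sets of kept letters. *)
Definition probes : seq (bitseq * bitseq) :=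
  [:: ([:: false; false; false; true], [:: false; true; false; false]);
      ([:: false; false; true; false], [:: true; false; false; false]);
      ([:: false; false; false; true], [:: true; false; false; false]);
      ([:: false; false; true; true], [:: true; true; false; false])].

(** {1,4} = {3,4} and {1,2} = {1,4}: the first two probes with a common last,
    respectively first, letter added. *)
Definition translates : seq (bitseq * bitseq) :=
  [:: ([:: true; false; false; true], [:: true; true; false; false]);
      ([:: false; false; true; true], [:: true; false; false; true])].

Definition signature (S : eqType) (s : block S) : seq bool :=
  [seq word_at s p.1 == word_at s p.2 | p <- probes].

(** The gap conditions at both ends and the equality of the numbers of letters
    leave only these pairs among the 256, which is checked by enumeration. *)
Lemma coincidence_cases (S : eqType) (s : block S) u v :
  reduced s -> dim s = 4 -> size u = 4 -> size v = 4 ->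
  word_at s u = word_at s v ->
  [|| u == v, (u, v) \in probes ++ translates
    | (v, u) \in probes ++ translates].
Proof.
move=> red d su sv e.
have cuv : count id u == count id v.
  move/(congr1 size): e; rewrite (size_word_at (u := u)) ?d //.
  rewrite (size_word_at (u := v)) ?d // => /eqP.
  by rewrite eqn_add2l.
have guv : gapped u v by apply: gapped_last e; rewrite ?d.
have guv' : gapped (rev u) (rev v).
  apply: (gapped_last (reduced_mirror red));
    rewrite ?size_rev ?dim_mirror ?d ?word_at_mirror ?e ?d //.
have /allP/(_ u)/[!mem_cube]/(_ (introT eqP su)) : all (fun u => all (fun v =>
    [&& count id u == count id v, gapped u v & gapped (rev u) (rev v)] ==>
    [|| u == v, (u, v) \in probes ++ translates
    | (v, u) \in probes ++ translates]) (cube 4)) (cube 4) by vm_compute.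
move/allP/(_ v)/[!mem_cube]/(_ (introT eqP sv)).
by rewrite cuv guv guv'.
Qed.

Lemma probes_translates (S : eqType) (s : block S) :
  dim s = 4 ->
  [seq word_at s p.1 == word_at s p.2 | p <- translates]
  = take 2 (signature s).
Proof.
move=> d; rewrite /=; congr [:: _; _]; first exact: word_at_cons.
by apply: (@word_at_rcons _ s true false [:: false; false; true]
  [:: true; false; false]); rewrite d.
Qed.

Lemma kernel_of_signature (S T : eqType) (s : block S) (t : block T) :
  reduced s -> reduced t -> dim s = 4 -> dim t = 4 ->
  signature s = signature t -> same_kernel false s t.
Proof.
move=> reds redt ds dt sgn u v; rewrite ds => su sv /=.
wlog suff : S T s t reds redt ds dt sgn /
    word_at s u = word_at s v -> word_at t u = word_at t v.
  by move=> W; apply/eqP/eqP; apply: W.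
have /eq_in_map agree :
    [seq word_at s p.1 == word_at s p.2 | p <- probes ++ translates]
    = [seq word_at t p.1 == word_at t p.2 | p <- probes ++ translates].
  by rewrite !map_cat !probes_translates // -/(signature s) sgn.
move=> e.
case/or3P: (coincidence_cases reds ds su sv e) => [/eqP-> //| |] /agree /=.
  by rewrite e eqxx => /esym/eqP.
by rewrite e eqxx => /esym/eqP.
Qed.

(** * Seven kernels *)

(** All kernels are computed over a concrete two-letter alphabet. *)
Definition std : 'I_6 -> block bool := standard_block true false.

Definition standard_signatures : seq (seq bool) :=
  [:: [:: true; true; false; true]; [:: true; false; false; false];
      [:: false; false; true; false]; [:: false; false; true; true];
      [:: false; false; false; true]; [:: false; false; false; false]].

Lemma signature_std (i : 'I_6) :
  signature (std i) = nth [::] standard_signatures i.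
Proof. by case: i => [[|[|[|[|[|[|]]]]]]] i6. Qed.

(** Transitivity and cancellation rule out nine of the sixteen signatures: the
    probe {1} = {4} excludes {1} = {3} and {2} = {4}, as {3} = {4} and
    {1} = {2} never hold, and among {1} = {3}, {2} = {4}, {1,2} = {3,4} any two
    imply the third, through {1,4}.  The signature with {2} = {4} alone is that
    of the second standard block read backwards. *)
Lemma signature_cases (S : eqType) (s : block S) :
  reduced s -> dim s = 4 ->
  exists r i, signature s = signature (if r then mirror (std i) else std i).
Proof.
move=> red d; set sgn := signature s.
suff : sgn \in [:: signature (mirror (std (inord 1)))
               & [seq signature (std i) | i : 'I_6]].
  rewrite inE => /orP[/eqP->|/imageP[i _ ->]]; first by exists true, (inord 1).
  by exists false, i.
have -> : [seq signature (std i) | i : 'I_6] = standard_signatures.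
  rewrite -[RHS](mkseq_nth [::]) /mkseq -val_enum_ord -map_comp.
  by apply: eq_map => i; rewrite signature_std.
have -> : inord 1 = Ordinal (isT : 1 < 6) by apply: val_inj; rewrite /= inordK.
have sep u v : ~~ gapped u v -> size u = 4 -> size v = 4 ->
    word_at s u <> word_at s v.
  by move=> ng su sv e; move/negP: ng; apply; apply: gapped_last e; rewrite ?d.
(* The coincidences {1,4} = {3,4} and {1,2} = {1,4}. *)
have [t13 t24] := probes_translates d.
rewrite /sgn /signature /=.
set p13 := _ == word_at s [:: false; true; _; _] in t13 *.
set p24 := word_at s [:: _; _; true; false] == _ in t24 *.
set p14 := word_at s [:: _; _; _; true] == word_at s [:: true; _; _; _].
set q := word_at s [:: _; _; true; true] == _.
have n13 : ~~ (p13 && p14).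
  apply/negP => /andP[/eqP e /eqP]; rewrite e.
  exact: (sep [:: false; true; false; false] [:: true; false; false; false]).
have n24 : ~~ (p24 && p14).
  apply/negP => /andP[/eqP e /eqP]; rewrite -e.
  exact: (sep [:: false; false; false; true] [:: false; false; true; false]).
have qE : p13 -> q = p24.
  by rewrite -t13 -t24 /q => /eqP ->.
have pE : p24 -> q = p13.
  by rewrite -t13 -t24 /q => /eqP ->.
case: p13 p24 p14 q {t13 t24} n13 n24 qE pE => [] [] [] [] //= _ _ h h'.
all: by [move: (h isT) | move: (h' isT)].
Qed.

(** * Existence *)

Fixpoint block_map (S T : Type) (f : S -> T) (s : block S) : block T :=
  match s with
  | Word x => Word (map f x)
  | Snoc s' a x => Snoc (block_map f s') (f a) (map f x)
  end.

Lemma dim_block_map (S T : Type) (f : S -> T) s : dim (block_map f s) = dim s.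
Proof. by elim: s => //= s ->. Qed.

Lemma word_at_map (S T : Type) (f : S -> T) s u :
  word_at (block_map f s) u = map f (word_at s u).
Proof.
by elim: s u => //= s IH a x u; rewrite IH !map_cat map_nseq.
Qed.

Lemma block_map_kernel (S T : eqType) (f : S -> T) (s : block S) :
  injective f -> same_kernel false s (block_map f s).
Proof. by move=> injf u v _ _; rewrite !word_at_map (inj_eq (inj_map injf)). Qed.

Lemma reduced_kernel (S T : eqType) (s : block S) (t : block T) :
  dim s = dim t -> same_kernel false s t -> reduced s -> reduced t.
Proof.
move=> d ker /reducedP red; apply/reducedP => u v; rewrite -d => suv /eqP.
by rewrite -[_ == _]ker ?size_cat /= ?addnS // => /eqP; apply: red.
Qed.

Definition letters (T : Type) (a b : T) (c : bool) := if c then a else b.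

Lemma standard_blockE (T : Type) (a b : T) i :
  standard_block a b i = block_map (letters a b) (std i).
Proof. by case: i => [[|[|[|[|[|[|]]]]]] i6]. Qed.

Lemma dim_std i : dim (std i) = 4.
Proof. by case: i => [[|[|[|[|[|[|]]]]]] i6]. Qed.

Lemma reduced_std i : reduced (std i).
Proof. by case: i => [[|[|[|[|[|[|]]]]]] i6]. Qed.

Lemma letters_inj (T : eqType) (a b : T) : a != b -> injective (letters a b).
Proof. by move=> ab [] [] //= e; rewrite e eqxx in ab. Qed.

Lemma same_kernel_comp (S T V : eqType) r (s : block S) (t : block T)
    (w : block V) :
  dim s = dim t -> same_kernel false s t -> same_kernel r t w ->
  same_kernel r s w.
Proof. by move=> d st tw u v su sv; rewrite st // tw // -d. Qed.

Lemma isomorphic_standard (S : eqType) (a b : S) (s : block S) :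
  a != b -> valid s -> dim s = 4 ->
  exists i, isomorphic s (standard_block a b i).
Proof.
move=> ab vs d; have /validP red := vs.
have [r [i sgn]] := signature_cases red d; exists i.
have ker : same_kernel r s (std i).
  case: r sgn => sgn.
    apply: (same_kernel_comp _ (kernel_of_signature _ _ _ _ sgn)) => //;
      rewrite ?dim_mirror ?dim_std ?d ?reduced_mirror ?reduced_std //.
    by apply: same_kernel_sym (@mirror_kernel _ _); rewrite dim_mirror.
  by apply: kernel_of_signature; rewrite ?reduced_std ?dim_std.
have ker' := block_map_kernel (letters_inj ab) (s := std i).
have di := dim_std i.
rewrite standard_blockE; apply: (@isomorphic_of_kernel r) => //.
- apply/validP; apply: reduced_kernel ker' (reduced_std i).
  by rewrite dim_block_map.
- by rewrite dim_block_map di.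
move=> u v su sv; rewrite ker //.
by rewrite ker' // size_flip ?su ?sv d.
Qed.

(** * Uniqueness *)

Definition bits m (I : {set 'I_m}) : bitseq :=
  [seq mem_nat I k | k <- rev (iota 0 m)].

Lemma size_bits m (I : {set 'I_m}) : size (bits I) = m.
Proof. by rewrite size_map size_rev size_iota. Qed.

Lemma labels_vertex m (I : {set 'I_m}) : labels I (~: I) m = map Some (bits I).
Proof.
rewrite /labels /mkseq -map_rev -map_comp; apply/eq_in_map => k.
rewrite mem_rev mem_iota /= => km; rewrite /label.
rewrite -[k]/(val (Ordinal km)) !mem_nat_ord inE.
by case: (_ \in I).
Qed.

Lemma nfree_Some u : nfree (map Some u) = 0.
Proof. by elim: u. Qed.

Lemma fill_Some u v : fill (map Some u) v = u.
Proof. by elim: u => //= b u ->. Qed.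

Lemma bits_inj m : injective (@bits m).
Proof.
move=> I J /eq_in_map e; apply/setP => i; rewrite -!mem_nat_ord; apply: e.
by rewrite mem_rev mem_iota /=.
Qed.

Lemma bits_cube m : perm_eq [seq bits A | A : {set 'I_m}] (cube m).
Proof.
apply: uniq_perm; last 1 first.
- move=> u; rewrite mem_cube; apply/imageP/eqP => [[A _ ->]|su].
    exact: size_bits.
  exists [set i : 'I_m | nth false (rev u) i] => //.
  rewrite -{1}[u]revK -{1}[rev u](mkseq_nth false) /mkseq -map_rev size_rev su.
  apply/eq_in_map => k; rewrite mem_rev mem_iota /= => km.
  by rewrite -[k in RHS]/(val (Ordinal km)) mem_nat_ord inE.
- by rewrite map_inj_uniq ?enum_uniq //; apply: bits_inj.
- exact: cube_uniq.
Qed.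

Lemma count_bits m (I : {set 'I_m}) : count id (bits I) = #|I|.
Proof.
rewrite /bits map_rev count_rev -val_enum_ord -map_comp count_map.
rewrite cardE {2}/enum_mem size_filter -enumT; apply: eq_count => i /=.
exact: mem_nat_ord.
Qed.

Lemma bits_union m (I J : {set 'I_m}) :
  bits (I :|: J) = [seq p.1 || p.2 | p <- zip (bits I) (bits J)].
Proof.
rewrite zip_map -map_comp; apply/eq_in_map => k.
rewrite mem_rev mem_iota /= => km.
by rewrite -[k]/(val (Ordinal km)) !mem_nat_ord inE.
Qed.

(** Counting coincidences alone does not separate the standard blocks: the
    second and the fourth have two each, {1} = {3}, {1,4} = {3,4} and
    {1} = {4}, {1,2} = {3,4}.  The sizes of the unions do. *)
Definition union_weight m (S : eqType) (s : block S) : nat :=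
  \sum_(I : {set 'I_m}) \sum_(J : {set 'I_m} |
    word_at s (bits I) == word_at s (bits J)) #|I :|: J|.

(** A vertex is the sub-block in which no coordinate is left free, and it is
    always valid, so an isomorphism preserves the kernel. *)
Lemma isomorphic_vertices (S : eqType) (s1 s2 : block S) :
  isomorphic s1 s2 -> exists p : {perm 'I_(dim s1)}, forall I J,
    (word_at s1 (bits I) == word_at s1 (bits J))
    = (word_at s2 (bits (p @: I)) == word_at s2 (bits (p @: J))).
Proof.
case=> _ _ d [p iso]; exists p => I J.
have [_] := iso I (~: I) J (~: J) (setICr I) (setICr J).
have imC (A : {set 'I_(dim s1)}) : p @: (~: A) = ~: (p @: A).
  apply/setP => x; rewrite inE -[x](permKV p) !mem_imset ?inE //;
    exact: perm_inj.
have equivE (s : block S) (A B : {set 'I_(dim s1)}) : dim s = dim s1 ->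
    equiv (subblock s A (~: A)) (subblock s B (~: B))
    /\ valid (subblock s A (~: A)) <->
    word_at s (bits A) = word_at s (bits B).
  move=> ds; rewrite valid_subblock equiv_subblock ds !labels_vertex.
  rewrite /face_eq /face_reduced !nfree_Some; split=> [[[_ /(_ [::] erefl)]]|e].
    by rewrite !fill_Some.
  by split=> //; split=> // u _; rewrite !fill_Some.
rewrite !imC !equivE // => e.
by apply/eqP/eqP => /e.
Qed.

Lemma union_weight_iso (S : eqType) (s1 s2 : block S) :
  isomorphic s1 s2 -> union_weight (dim s1) s1 = union_weight (dim s1) s2.
Proof.
case/isomorphic_vertices=> p ker.
have pinj : injective (fun I : {set 'I_(dim s1)} => p @: I).
  exact: imset_inj (@perm_inj _ p).
rewrite /union_weight [RHS](reindex_inj pinj); apply: eq_bigr => I _.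
rewrite [RHS](reindex_inj pinj); apply: eq_big => [J|J _]; first exact: ker.
by rewrite -imsetU card_imset //; apply: perm_inj.
Qed.

(** The form of [union_weight] that can be evaluated: the vertices are
    enumerated as lists of bits instead of sets. *)
Definition cube_weight m (S : eqType) (s : block S) : nat :=
  sumn [seq sumn [seq count id [seq p.1 || p.2 | p <- zip u v]
    | v <- cube m & word_at s u == word_at s v] | u <- cube m].

Lemma union_weightE m (S : eqType) (s : block S) :
  union_weight m s = cube_weight m s.
Proof.
rewrite /union_weight /cube_weight sumnE big_map -(perm_big _ (bits_cube m)) /=.
rewrite big_image /=; apply: eq_bigr => I _.
rewrite sumnE big_map big_filter -(perm_big _ (bits_cube m)) /=.
rewrite big_image_cond /=; apply: eq_big => // J _.
by rewrite -bits_union count_bits.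
Qed.

Lemma cube_weight_kernel m (S T : eqType) (s : block S) (t : block T) :
  dim s = m -> same_kernel false s t -> cube_weight m s = cube_weight m t.
Proof.
move=> d ker; congr sumn; apply/eq_in_map => u; rewrite mem_cube => /eqP su.
congr sumn; congr map; apply/eq_in_filter => v; rewrite mem_cube => /eqP sv.
by rewrite ker ?d.
Qed.

(** The pairs I = J contribute 32, the sum of the sizes of the subsets of a
    set with four elements; every other coincidence is counted twice. *)
Definition standard_weights : seq nat := [:: 60; 42; 36; 44; 40; 32].

Lemma cube_weight_std i :
  cube_weight 4 (std i) = nth 0 standard_weights i.
Proof.
(* The last case is an index out of range, where evaluation is stuck. *)
by case: i => [[|[|[|[|[|[|i]]]]]] i6]; [vm_compute.. | case: (notF i6)].
Qed.

Lemma isomorphic_weight (S : eqType) (a b : S) (s : block S) i :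
  a != b -> dim s = 4 -> isomorphic s (standard_block a b i) ->
  union_weight 4 s = nth 0 standard_weights i.
Proof.
move=> ab d /union_weight_iso; rewrite d => ->.
rewrite union_weightE standard_blockE -cube_weight_std; symmetry.
exact: cube_weight_kernel (dim_std i) (block_map_kernel (letters_inj ab)).
Qed.

Theorem theorem3p29 (Sigma : finType) (a b : Sigma) (sigma : block Sigma) :
  a != b -> valid sigma -> dim sigma = 4 ->
  exists! i : 'I_6, isomorphic sigma (standard_block a b i).
Proof.
move=> ab vs d; have [i iso] := isomorphic_standard ab vs d.
exists i; split=> // j iso'; apply/val_inj/eqP.
have := isomorphic_weight ab d iso'; rewrite (isomorphic_weight ab d iso).
by move/eqP; rewrite nth_uniq ?ltn_ord.
Qed.
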